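(* Let $\mathcal{M}$ be an acyclic oriented matroid on a finite ground set $S$ with Las Vergnas face lattice $\mathcal{L}(\mathcal{M})$ and flat lattice $\mathcal{F}l(\mathcal{M})$. Then: (1) any flatial building set $\mathcal{G}$ for $\mathcal{M}$ yields a facial building set $\mathcal{F}=\mathcal{G}\cap\mathcal{L}(\mathcal{M})$ for $\mathcal{M}$, and the facial nested complex of $\mathcal{F}$ is a subcomplex of the flatial nested complex of $\mathcal{G}$; (2) if all the elements of $\mathcal{M}$ are in $\mathcal{L}(\mathcal{M})$ (i.e. $\{s\}\in\mathcal{L}(\mathcal{M})$ for all $s\in S$), then the facial nested complex of any facial building set $\mathcal{F}$ for $\mathcal{M}$ is a subcomplex of the flatial nested complex of the flatial building set $\mathcal{G}$ for $\mathcal{M}$ obtained as the $\mathcal{F}l(\mathcal{M})$-building closure of $\mathcal{F}$.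
   Context: An oriented matroid $\mathcal{M}$ on $S$ is acyclic if $(S,\varnothing)$ is a covector. A face of an acyclic $\mathcal{M}$ is a set $F\subseteq S$ such that $(S\setminus F,\varnothing)$ is a covector; faces ordered by inclusion form the Las Vergnas face lattice $\mathcal{L}(\mathcal{M})$. A flat of $\mathcal{M}$ is a set $S\setminus(v_+\cup v_-)$ for a covector $v=(v_+,v_-)$ of $\mathcal{M}$; flats ordered by inclusion form the flat lattice $\mathcal{F}l(\mathcal{M})$. Every face is a flat. For a finite lattice $\mathcal{L}$ with bottom $\hat 0$, an $\mathcal{L}$-building set is a subset $\mathcal{B}\subseteq\mathcal{L}_{>\hat 0}$ such that for every $Y\in\mathcal{L}_{>\hat 0}$, with $\{B_1,\dots,B_k\}=\max(\mathcal{B}_{\le Y})$, there is a poset isomorphism $\prod_{j}\mathcal{L}_{\le B_j}\to\mathcal{L}_{\le Y}$ whose $j$-th component is the inclusion. Let $\kappa(\mathcal{B})=\max(\mathcal{B})$. An $\mathcal{L}$-nested set on $\mathcal{B}$ is a subset $\mathcal{N}\subseteq\mathcal{B}$ containing $\kappa(\mathcal{B})$ such that for any $k\ge2$ pairwise incomparable $B_1,\dots,B_k\in\mathcal{N}\setminus\kappa(\mathcal{B})$, the join $B_1\vee\cdots\vee B_k$ (in $\mathcal{L}$) is not in $\mathcal{B}$. The $\mathcal{L}$-nested complex of $\mathcal{B}$ is the simplicial complex with faces $\mathcal{N}\setminus\kappa(\mathcal{B})$. The $\mathcal{L}$-building closure of $\mathcal{X}\subseteq\mathcal{L}_{>\hat0}$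 is the unique inclusion-minimal $\mathcal{L}$-building set containing $\mathcal{X}$ (it exists). A facial (resp. flatial) building set for $\mathcal{M}$ is an $\mathcal{L}(\mathcal{M})$-building set (resp. $\mathcal{F}l(\mathcal{M})$-building set); its facial (resp. flatial) nested complex is its $\mathcal{L}(\mathcal{M})$-nested complex (resp. $\mathcal{F}l(\mathcal{M})$-nested complex). *)

(* Defs.v *)
From HB Require Import structures.
From mathcomp Require Import all_boot all_order.

Set Implicit Arguments.
Unset Strict Implicit.
Unset Printing Implicit Defensive.

Import Order.TTheory.

Section Nested.
Local Open Scope order_scope.
Context {d : Order.disp_t} {L : finTBLatticeType d}.
Implicit Types (A B N : {set L}) (X Y : L).

Definition maximals A : {set L} :=
  [set X in A | [forall Y in A, (X <= Y) ==> (Y == X)]].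

Definition lower (Y : L) : Type := {X : L | X <= Y}.

Definition lower_prod A : Type :=
  {dffun forall j : {C : L | C \in A}, lower (val j)}.

(* The last clause is "the j-th component of phi is the inclusion": a tuple
   whose components other than the j-th are all \bot is sent to its j-th
   component. *)
Definition factorization A Y (phi : lower_prod A -> lower Y) : Prop :=
  [/\ bijective phi,
      forall f g : lower_prod A,
        (val (phi f) <= val (phi g)) = [forall j, val (f j) <= val (g j)]
    & forall (f : lower_prod A) (j : {C : L | C \in A}),
        (forall i, i != j -> val (f i) = \bot) -> val (phi f) = val (f j)].

Definition building_set B : Prop :=
  \bot \notin B /\
  forall Y, Y != \bot ->
    exists phi : lower_prod (maximals [set X in B | X <= Y]) -> lower Y,
      factorization phi.

Definition antichain A : bool :=
  [forall X in A, forall Y in A, (X != Y) ==> (X >< Y)].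

Definition nested_set B N : bool :=
  [&& N \subset B, maximals B \subset N
    & [forall A : {set L},
        [&& A \subset N :\: maximals B, (1 < #|A|)%N & antichain A] ==>
        (\join_(X in A) X \notin B)]].

Definition nested_complex B : {set {set L}} :=
  [set N :\: maximals B | N in [set N | nested_set B N]].

(* Minimality for inclusion; a unique such G exists whenever \bot \notin A. *)
Definition building_closure A (G : {set L}) : Prop :=
  [/\ building_set G, A \subset G
    & forall G' : {set L},
        building_set G' -> A \subset G' -> G' \subset G -> G' = G].

End Nested.

Record intersection_family (S : finType) := IntersectionFamily {
  members :> {set {set S}};
  members_setT : setT \in members;
  members_setI : forall X Y, X \in members -> Y \in members ->
    X :&: Y \in members
}.

Fact inclusion_display : Order.disp_t. Proof. exact: Order.Disp tt tt. Qed.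

Section FamilyLattice.
Variables (S : finType) (C : intersection_family S).

Record member := Member {
  member_set :> {set S};
  _ : member_set \in members C
}.

HB.instance Definition _ := [isSub for member_set].
HB.instance Definition _ := [Finite of member by <:].

Implicit Types X Y Z : member.

Definition member_le X Y := val X \subset val Y.

Fact member_le_refl : reflexive member_le.
Proof. by move=> X; exact: subxx. Qed.

Fact member_le_anti : antisymmetric member_le.
Proof. by move=> X Y XY; apply/val_inj/eqP; rewrite eqEsubset. Qed.

Fact member_le_trans : transitive member_le.
Proof. by move=> Y X Z; exact: subset_trans. Qed.

HB.instance Definition _ := Order.Le_isPOrder.Build inclusion_display member
  member_le_refl member_le_anti member_le_trans.

Fact member_hull_subproof (A : {set S}) :
  \bigcap_(Z : member | A \subset val Z) val Z \in members C.
Proof.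
elim/big_ind: _ => [|X Y|Z _].
- exact: members_setT.
- exact: members_setI.
- exact: valP.
Qed.

Definition member_hull A : member := Member (member_hull_subproof A).

Definition member_meet X Y : member :=
  Member (members_setI (valP X) (valP Y)).

Definition member_join X Y : member := member_hull (val X :|: val Y).

Lemma member_hullP (A : {set S}) Z :
  (val (member_hull A) \subset val Z) = (A \subset val Z).
Proof.
apply/idP/idP => [|AZ]; last exact: bigcap_inf.
by apply: subset_trans; apply/bigcapsP.
Qed.

Fact member_meetP X Y Z :
  (X <= member_meet Y Z)%O = (X <= Y)%O && (X <= Z)%O.
Proof. exact: subsetI. Qed.

Fact member_joinP X Y Z :
  (member_join X Y <= Z)%O = (X <= Z)%O && (Y <= Z)%O.
Proof. by rewrite [LHS]member_hullP subUset. Qed.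

HB.instance Definition _ := Order.POrder_MeetJoin_isLattice.Build
  inclusion_display member member_meetP member_joinP.

Fact member_bottomP X : (member_hull set0 <= X)%O.
Proof. by have := sub0set (val X); rewrite -member_hullP. Qed.

Fact member_topP X : (X <= Member (members_setT C))%O.
Proof. exact: subsetT. Qed.

HB.instance Definition _ :=
  Order.hasBottom.Build inclusion_display member member_bottomP.
HB.instance Definition _ :=
  Order.hasTop.Build inclusion_display member member_topP.

End FamilyLattice.

Section SignVectors.
Variable S : finType.

Definition sign_vector : Type := ({set S} * {set S})%type.

Implicit Types u v : sign_vector.

Definition supp v : {set S} := v.1 :|: v.2.
Definition sv_opp v : sign_vector := (v.2, v.1).
Definition sv_comp u v : sign_vector :=
  (u.1 :|: (v.1 :\: supp u), u.2 :|: (v.2 :\: supp u)).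
Definition sep u v : {set S} := (u.1 :&: v.2) :|: (u.2 :&: v.1).

End SignVectors.

(* The covector axioms; (v.1, v.2) is the pair (v_+, v_-). *)
Record oriented_matroid (S : finType) := OrientedMatroid {
  covectors : {set sign_vector S};
  covector_disjoint : forall v, v \in covectors -> [disjoint v.1 & v.2];
  covector0 : (set0, set0) \in covectors;
  covector_opp : forall v, v \in covectors -> sv_opp v \in covectors;
  covector_comp : forall u v,
    u \in covectors -> v \in covectors -> sv_comp u v \in covectors;
  covector_elim : forall u v s,
    u \in covectors -> v \in covectors -> s \in sep u v ->
    exists2 w, w \in covectors &
      [/\ s \notin supp w,
          w.1 :\: sep u v = (sv_comp u v).1 :\: sep u v
        & w.2 :\: sep u v = (sv_comp u v).2 :\: sep u v]
}.

Section FacesFlats.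
Variables (S : finType) (M : oriented_matroid S).

Definition acyclic : bool := (setT, set0) \in covectors M.

Definition faces : {set {set S}} :=
  [set F : {set S} | (~: F, set0) \in covectors M].

Definition flats : {set {set S}} := [set ~: supp v | v in covectors M].

Lemma face_is_flat F : F \in faces -> F \in flats.
Proof.
rewrite inE => Fcov; apply/imsetP; exists (~: F, set0) => //.
by rewrite /supp setU0 setCK.
Qed.

Fact faces_setT : setT \in faces.
Proof. by rewrite inE setCT covector0. Qed.

Fact faces_setI X Y : X \in faces -> Y \in faces -> X :&: Y \in faces.
Proof.
rewrite !inE => cX cY.
suff -> : (~: (X :&: Y), set0) = sv_comp (~: X, set0) (~: Y, set0).
  exact: covector_comp.
rewrite /sv_comp /supp; congr pair; apply/setP=> s; rewrite !inE /=.
  by do 2!case: (s \in _).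
by rewrite andbF.
Qed.

Fact flats_setT : setT \in flats.
Proof. exact: face_is_flat faces_setT. Qed.

Fact flats_setI X Y : X \in flats -> Y \in flats -> X :&: Y \in flats.
Proof.
case/imsetP=> u cu -> /imsetP[v cv ->]; apply/imsetP.
exists (sv_comp u v); first exact: covector_comp.
rewrite /sv_comp /supp /= -setCU; congr (~: _); apply/setP=> s; rewrite !inE.
by do !case: (s \in _).
Qed.

Definition face_family := IntersectionFamily faces_setT faces_setI.
Definition flat_family := IntersectionFamily flats_setT flats_setI.

Definition face_lattice := member face_family.
Definition flat_lattice := member flat_family.

Definition face_flat (F : face_lattice) : flat_lattice :=
  @Member S flat_family (val F) (face_is_flat (valP F)).

Definition facial_part (G : {set flat_lattice}) : {set face_lattice} :=
  [set F | face_flat F \in G].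

Definition subcomplex (K : {set {set face_lattice}})
    (K' : {set {set flat_lattice}}) : Prop :=
  forall N, N \in K -> face_flat @: N \in K'.

End FacesFlats.

(* Main.v *)
Require Import Defs.
From mathcomp Require Import all_boot all_order.

Set Implicit Arguments.
Unset Strict Implicit.
Unset Printing Implicit Defensive.

Import Order.TTheory.

(** Both lattices consist of subsets of [S] and are closed under intersection,
    so the proof first removes the poset isomorphisms from the notion of
    building set. Say that a closed set [W] splits as [A], [A'] when it is the
    disjoint union of these nonempty closed sets and every union of a closed
    subset of [A] with a closed subset of [A'] is closed. Then a set [B] of
    nonempty closed sets is a building set as soon as every nonempty closed
    set outside [B] has a splitting such that each member of [B] below it lies
    in one of the two halves ([splitting_building]). The converse
    ([building_splitting]) holds when the hulls of the points partition [S],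
    as they do for flats, and for faces if every point is a face.

    Oriented matroids enter by a comparison of the two kinds of splittings of
    a face. If a face splits in the flat lattice, the same halves split it in
    the face lattice ([splits_faces]): this is the fact that a direct sum of
    matroids is a direct sum of oriented matroids, so that its faces are the
    unions of faces of the summands. Conversely, halves that split a face in
    the face lattice split it in the flat lattice ([splits_flats]): the faces
    below a given one contain a chain that is maximal among flats, hence they
    determine the rank, and a product of face lattices forces the ranks to add
    up. Both directions rest on [face_enlarge], which moves from a face
    towards a larger flat and stops at the first face on the way.

    (1) A face outside [G] splits along [G] in the flat lattice, hence in the
    face lattice, so the faces of [G] form a building set. Repeated splitting
    of [setT] shows that the maximal elements of [G] are faces. If the join of
    some faces in the flat lattice is in [G], it lies in one half of any
    splitting of their join in the face lattice; this half is a face, so it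
    contains that join, which is absurd. Hence the join in the face lattice is
    in [G] too, and nested sets remain nested.

    (2) It is enough to show that the closure [G] of [F] contains no face
    outside [F], for then (1) applies. Let [G'] consist of the flats [X] in
    [G] such that below every face that contains [X] there is an element of
    [F] that still contains [X]. A face in [G'] is in [F]. By [splits_flats],
    [G'] is a flatial building set; it contains [F], so it is equal to [G]. *)

(** * Splittings in a family closed under intersection *)

Section Families.
Variables (S : finType) (C : intersection_family S).
Implicit Types (A W : {set S}) (B K : {set member C}) (X Y Z : member C).

Definition hull A : {set S} := val (member_hull C A).

Lemma member_inj X Y : val X = val Y -> X = Y.
Proof. exact: val_inj. Qed.

Lemma leE X Y : (X <= Y)%O = (val X \subset val Y).
Proof. by []. Qed.

Lemma sub_hull A : A \subset hull A.
Proof. by rewrite -(member_hullP A (member_hull C A)) subxx. Qed.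

Lemma hull_sub A W : W \in members C -> A \subset W -> hull A \subset W.
Proof. by move=> CW AW; have := member_hullP A (Member CW); rewrite AW. Qed.

Lemma mem_hull_sub A W x :
  x \in hull A -> W \in members C -> A \subset W -> x \in W.
Proof. by move=> xA CW /(hull_sub CW)/subsetP->. Qed.

Lemma hull_in A : hull A \in members C.
Proof. exact: valP. Qed.

Lemma mem_hullP A x :
  reflect (forall W, W \in members C -> A \subset W -> x \in W) (x \in hull A).
Proof.
apply: (iffP idP) => [xA W CW AW|]; first exact: mem_hull_sub AW.
by apply; [exact: hull_in | exact: sub_hull].
Qed.

Lemma hull_mono A W : A \subset W -> hull A \subset hull W.
Proof.
by move=> AW; apply: hull_sub (hull_in _) (subset_trans AW (sub_hull _)).
Qed.

(** For flats of a loopless matroid this is the exchange axiom for points; it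
    makes the hulls of the points the blocks of a partition of [S]. *)
Definition point_symmetric : Prop :=
  forall x y, x \in hull [set y] -> y \in hull [set x].

Record splits W A A' : Prop := Splits {
  split_l : A \in members C;
  split_r : A' \in members C;
  split_l0 : A != set0;
  split_r0 : A' != set0;
  split_disj : [disjoint A & A'];
  split_cover : A :|: A' = W;
  split_closed : forall U V, U \in members C -> V \in members C ->
    U \subset A -> V \subset A' -> U :|: V \in members C
}.

Definition refines W B A A' : Prop :=
  forall X, X \in B -> val X \subset W ->
    val X \subset A \/ val X \subset A'.

Lemma splits_sym W A A' : splits W A A' -> splits W A' A.
Proof.
case=> CA CA' A0 A'0 AA' <- Acl; split=> //; first by rewrite disjoint_sym.
  exact: setUC.
by move=> U V CU CV UA VA'; rewrite setUC; exact: Acl.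
Qed.

Lemma splits_proper W A A' : splits W A A' -> #|A| < #|W|.
Proof.
case=> _ _ _ A'0 AA' <- _.
by rewrite cardsU disjoint_setI0 // cards0 subn0 -addn1 leq_add2l card_gt0.
Qed.

(** It is enough to replace one half at a time, because [U :|: V] is the
    intersection of [U :|: A'] and [V :|: A]. *)
Lemma splits_of_halves W A A' : set0 \in members C ->
    A != set0 -> A' != set0 -> [disjoint A & A'] -> A :|: A' = W ->
    (forall U, U \in members C -> U \subset A -> U :|: A' \in members C) ->
    (forall V, V \in members C -> V \subset A' -> V :|: A \in members C) ->
  splits W A A'.
Proof.
move=> C0 A0 A'0 AA' AUA' Al Ar.
have CA : A \in members C by rewrite -[A]set0U Ar ?sub0set.
have CA' : A' \in members C by rewrite -[A']set0U Al ?sub0set.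
split=> // U V CU CV UA VA'.
suff -> : U :|: V = (U :|: A') :&: (V :|: A) by rewrite members_setI ?Al ?Ar.
apply/setP=> x; rewrite !inE; have := subsetP UA x; have := subsetP VA' x.
move/disjoint_setI0/setP/(_ x): AA'; rewrite !inE.
case: (x \in A); case: (x \in A'); case: (x \in U); case: (x \in V) => //=;
  by move=> _ H1 H2; (have := H1 isT) || (have := H2 isT).
Qed.

(** The set-theoretic content of a factorization of the interval below [Z]
    with factors [K]: the last clause says that closedness is tested
    blockwise. *)
Definition decomposes K Z : Prop :=
  [/\ forall X, X \in K -> val X \subset val Z,
      forall X Y, X \in K -> Y \in K -> X != Y -> [disjoint val X & val Y],
      forall x, x \in val Z -> exists2 X, X \in K & x \in val X
    & forall W, W \subset val Z ->
        (forall X, X \in K -> W :&: val X \in members C) -> W \in members C].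

Hypothesis C0 : set0 \in members C.

Lemma val_bottom : val (\bot%O : member C) = set0.
Proof.
by apply/eqP; rewrite -subset0; apply: hull_sub C0 _; exact: sub0set.
Qed.

Lemma bottomE X : (X == \bot%O) = (val X == set0).
Proof. by rewrite -val_eqE val_bottom. Qed.

Definition in_lower Z X (XZ : (X <= Z)%O) : lower Z :=
  exist (fun X => (X <= Z)%O) X XZ.

(** Meeting each component with its index turns any family of closed sets into
    an element of the product. *)
Definition meet_tuple K (g : {X : member C | X \in K} -> member C) :
    lower_prod K :=
  [ffun i => in_lower (leIr (val i) (g i))].

Lemma meet_tupleE K g i :
  val (val (@meet_tuple K g i)) = val (g i) :&: val (val i).
Proof. by rewrite ffunE. Qed.

Definition single K (j : {X : member C | X \in K}) (X : member C) :
    lower_prod K :=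
  meet_tuple (fun i => if i == j then X else \bot%O).

Lemma single_off K (j i : {X : member C | X \in K}) X :
  i != j -> val (single j X i) = \bot%O.
Proof.
move=> ij; apply/eqP; rewrite bottomE meet_tupleE (negPf ij) val_bottom.
by rewrite set0I.
Qed.

Lemma single_on K (j : {X : member C | X \in K}) X :
  val X \subset val (val j) -> val (single j X j) = X.
Proof.
by move=> Xj; apply: val_inj; rewrite meet_tupleE eqxx; apply/setIidPl.
Qed.

(** A factorization sends the tuple with single component [X] to [X], so [X]
    is below [phi f] exactly when it is below the component of [f] there.
    Taking for [X] the meet of two factors gives disjointness. Taking the hull
    of a point [x] of [Z] gives the rest: some component of its preimage is
    not [\bot] and, by symmetry, contains [x], so [x] is in a factor; and then
    the image of a tuple contains [x] exactly when one of its components does.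
    *)
Lemma factorization_decomposes K Z (phi : lower_prod K -> lower Z) :
    point_symmetric ->
    (forall X, X \in K -> val X \subset val Z) ->
  factorization phi -> decomposes K Z.
Proof.
move=> sym KZ [[psi _ phiK] phi_le phi_incl].
have phi_single (j : {X | X \in K}) X :
    val X \subset val (val j) -> val (phi (single j X)) = X.
  move=> Xj; rewrite (phi_incl _ j) ?single_on // => i.
  exact: single_off.
have single_le (j : {X | X \in K}) X (f : lower_prod K) :
    val X \subset val (val j) ->
    (X <= val (phi f))%O = (X <= val (f j))%O.
  move=> Xj; rewrite -{1}(phi_single j X Xj) phi_le.
  apply/forallP/idP => [/(_ j)|Xf i]; first by rewrite single_on.
  case: (eqVneq i j) => [->|ij]; first by rewrite single_on.
  by rewrite single_off // le0x.
have cover x : x \in val Z -> exists2 X, X \in K & x \in val X.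
  move=> xZ.
  have PZ : (member_hull C [set x] <= Z)%O by rewrite leE member_hullP sub1set.
  pose f := psi (in_lower PZ).
  have fE : val (phi f) = member_hull C [set x] by rewrite phiK.
  have xP : x \in hull [set x] by rewrite -sub1set sub_hull.
  have [j fj0|f0] := pickP (fun j => val (f j) != \bot%O).
    exists (val j); first exact: valP.
    have fjj : val (val (f j)) \subset val (val j) := valP (f j).
    move: fj0; rewrite bottomE => /set0Pn[y yf].
    have /subsetP/(_ y yf) : (val (f j) <= val (phi f))%O.
      by rewrite (single_le j).
    (* the component meets the hull of x in some y, whose hull contains x *)
    rewrite fE => /sym xy; apply: (subsetP fjj).
    by apply: (subsetP _ x xy); apply: hull_sub (valP _) _; rewrite sub1set.
  (* otherwise f is below the preimage g of bottom, so the hull is empty *)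
  pose g := psi (in_lower (le0x Z)).
  have : (val (phi f) <= val (phi g))%O.
    rewrite phi_le; apply/forallP=> j.
    by move/negbFE/eqP: (f0 j) => ->; rewrite le0x.
  rewrite fE phiK /= leE val_bottom => /subsetP/(_ x xP).
  by rewrite inE.
split=> // [X Y KX KY XY|W WZ WK].
  rewrite -setI_eq0; apply/eqP.
  pose i : {X | X \in K} := exist _ X KX.
  pose j : {X | X \in K} := exist _ Y KY.
  have ij : i != j by [].
  have mi : val (Order.meet X Y) \subset val (val i) by exact: subsetIl.
  have mj : val (Order.meet X Y) \subset val (val j) by exact: subsetIr.
  have : (Order.meet X Y <= val (phi (single j (Order.meet X Y))))%O.
    by rewrite phi_single.
  by rewrite (single_le i) // single_off // lex0 bottomE => /eqP.
pose f := meet_tuple (fun i : {X | X \in K} => Member (WK _ (valP i))).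
have fE i : val (val (f i)) = W :&: val (val i).
  by rewrite meet_tupleE /= -setIA setIid.
suff -> : W = val (val (phi f)) by exact: valP.
have pfZ : val (val (phi f)) \subset val Z := valP (phi f).
apply/setP=> x; apply/idP/idP => [xW|xf].
  have [X KX xX] := cover x (subsetP WZ x xW).
  pose j : {X | X \in K} := exist _ X KX.
  have fjj : val (val (f j)) \subset val (val j) := valP (f j).
  have : (val (f j) <= val (phi f))%O by rewrite (single_le j).
  by move=> /subsetP; apply; rewrite fE !inE xW.
have [X KX xX] := cover x (subsetP pfZ x xf).
pose j : {X | X \in K} := exist _ X KX.
have : (member_hull C [set x] <= val (phi f))%O.
  by rewrite leE member_hullP sub1set.
rewrite (single_le j) ?member_hullP ?sub1set // leE member_hullP sub1set fE.
by rewrite inE => /andP[].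
Qed.

(** The isomorphism is the union of the components; its inverse intersects
    with each factor. *)
Lemma decomposes_factorization K Z :
  decomposes K Z -> exists phi : lower_prod K -> lower Z, factorization phi.
Proof.
case=> KZ Kdisj Kcover Kclosed.
pose U (f : lower_prod K) : {set S} := \bigcup_i val (val (f i)).
have fsub (f : lower_prod K) i : val (val (f i)) \subset val (val i).
  exact: (valP (f i)).
have UI f i : U f :&: val (val i) = val (val (f i)).
  apply/setP=> x; rewrite inE; apply/andP/idP => [[/bigcupP[j _ xj] xi]|xi].
    case: (eqVneq i j) xj => [-> //|ij] xj.
    have := Kdisj _ _ (valP i) (valP j) ij.
    by move/disjointFr/(_ xi); rewrite (subsetP (fsub f j)).
  split; first by apply/bigcupP; exists i.
  exact: (subsetP (fsub f i)).
have UZ f : U f \subset val Z.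
  by apply/bigcupsP=> i _; apply: subset_trans (fsub f i) (KZ _ (valP i)).
have UC f : U f \in members C.
  by apply: Kclosed => // X KX; rewrite (UI f (exist _ X KX)); exact: valP.
exists (fun f => @in_lower Z (Member (UC f)) (UZ f)).
have U_le f g : (U f \subset U g) = [forall j, (val (f j) <= val (g j))%O].
  apply/idP/forallP => [fg j|fg]; first by rewrite leE -!UI setSI.
  by apply/bigcupsP=> i _; apply: subset_trans (fg i) (bigcup_sup i _).
split=> //.
  exists (fun X : lower Z => meet_tuple (fun=> val X)) => [f|X].
    apply/ffunP=> i; do 2!apply: val_inj.
    by rewrite meet_tupleE /= -(UI f i).
  do 2!apply: val_inj; apply/setP=> x /=; apply/bigcupP/idP => [[i _]|xX].
    by rewrite meet_tupleE inE => /andP[].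
  have XZ : val (val X) \subset val Z := valP X.
  have [Y KY xY] := Kcover x (subsetP XZ x xX).
  by exists (exist _ Y KY) => //; rewrite meet_tupleE inE xX.
move=> f j fj; apply: val_inj; rewrite /= -(UI f j); apply/esym/setIidPl.
apply/bigcupsP=> i _; case: (eqVneq i j) => [-> //|ij].
by rewrite fj // val_bottom sub0set.
Qed.

Lemma maximal_below B X Z : X \in B -> val X \subset val Z ->
  exists2 Y, Y \in maximals [set X in B | (X <= Z)%O] & val X \subset val Y.
Proof.
move=> BX XZ; pose P Y := [&& Y \in B, (Y <= Z)%O & (X <= Y)%O].
have PX : P X by apply/and3P.
have [/= Y /and3P[BY YZ XY] Ymax] := arg_maxnP (fun Y => #|val Y|) PX.
exists Y => //; rewrite !inE BY YZ /=; apply/forall_inP=> W; rewrite inE.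
case/andP=> BW WZ; apply/implyP=> YW.
have /Ymax : P W by rewrite /P BW WZ (le_trans XY YW).
by rewrite eq_sym -val_eqE eqEcard => ->; rewrite andbT; exact: YW.
Qed.

(** The building set condition with two factors at a time, and without a choice
    of isomorphisms. *)
Definition splitting B : Prop :=
  forall Z, val Z != set0 -> Z \notin B ->
    exists A A', splits (val Z) A A' /\ refines (val Z) B A A'.

(** One of the maximal elements of [B] below [Z] and the union of all the
    others are the two halves. *)
Lemma building_splitting B :
    point_symmetric -> building_set B -> splitting B.
Proof.
move=> sym [_ Bfact] Z Z0 BZ.
have [|phi phiF] := Bfact Z; first by rewrite bottomE.
set K := maximals _ in phi phiF.
have KB X : X \in K -> X \in B /\ val X \subset val Z.
  by rewrite !inE => /andP[/andP[]].
have [KZ Kdisj Kcover Kclosed] :=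
  factorization_decomposes sym (fun X KX => (KB X KX).2) phiF.
have /set0Pn[x xZ] := Z0; have [X KX xX] := Kcover x xZ.
have [BX XZ] := KB X KX.
exists (val X), (val Z :\: val X); split.
  have rest_closed : val Z :\: val X \in members C.
    apply: Kclosed => [|Y KY]; first exact: subsetDl.
    case: (eqVneq X Y) => [<-|XY].
      by rewrite setIDAC -setIDA setDv setI0.
    suff -> : (val Z :\: val X) :&: val Y = val Y by exact: valP.
    apply/setIidPr; rewrite subsetD KZ //= disjoint_sym.
    exact: Kdisj.
  split=> //.
  - exact: valP.
  - by apply/set0Pn; exists x.
  - rewrite setD_eq0; apply: contra BZ => ZX.
    by suff -> : Z = X by []; apply/le_anti; rewrite !leE ZX.
  - by rewrite -setI_eq0 setIC setIDAC -setIDA setDv setI0.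
  - by rewrite -{1}(setIidPr XZ) setID.
  - move=> U V CU CV UX; rewrite subsetD => /andP[VZ VX].
    apply: Kclosed => [|Y KY]; first by rewrite subUset VZ (subset_trans UX).
    rewrite setIUl; case: (eqVneq X Y) => [<-|XY].
      suff -> : V :&: val X = set0 by rewrite setU0 (setIidPl UX).
      by apply/eqP; rewrite setI_eq0.
    suff -> : U :&: val Y = set0.
      by rewrite set0U; apply: members_setI => //; exact: valP.
    by apply/eqP; rewrite setI_eq0 (disjointWl UX) // Kdisj.
move=> Y BY YZ; have [W KW YW] := maximal_below BY YZ.
case: (eqVneq W X) => [<-|WX]; [by left | right].
by rewrite subsetD YZ (disjointWl YW) // Kdisj.
Qed.

Lemma decomposes_self Z : decomposes [set Z] Z.
Proof.
split.
- by move=> X /set1P->.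
- by move=> X Y /set1P-> /set1P->; rewrite eqxx.
- by move=> x xZ; exists Z; rewrite ?inE.
- by move=> W WZ /(_ Z (set11 Z)); rewrite (setIidPl WZ).
Qed.

(** By induction on the size of [Z]: when [Z] splits along [B], the maximal
    elements of [B] below [Z] are those below either half. *)
Lemma splitting_decomposes B Z :
    \bot%O \notin B -> splitting B -> val Z != set0 ->
  decomposes (maximals [set X in B | (X <= Z)%O]) Z.
Proof.
move=> B0 Bsplit.
have [n] := ubnP #|val Z|; elim: n => // n IHn in Z *; rewrite ltnS => Zn Z0.
have [BZ|/(Bsplit Z Z0)[A [A' [sp Bref]]]] := boolP (Z \in B).
  suff -> : maximals [set X in B | (X <= Z)%O] = [set Z].
    exact: decomposes_self.
  apply/setP=> X; rewrite !inE; apply/andP/eqP => [[/andP[_ XZ]]|->].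
    by move/forall_inP/(_ Z); rewrite !inE BZ lexx XZ => /(_ isT)/eqP.
  rewrite BZ lexx; split=> //; apply/forall_inP=> Y; rewrite inE.
  by case/andP=> _ YZ; apply/implyP=> ZY; rewrite eq_le YZ ZY.
have [CA CA' A0 A'0 AA' AUA' Acl] := sp.
have AZ : A \subset val Z by rewrite -AUA' subsetUl.
have A'Z : A' \subset val Z by rewrite -AUA' subsetUr.
have [KA dA cA clA] := IHn (Member CA) (leq_trans (splits_proper sp) Zn) A0.
have [KA' dA' cA' clA'] :=
  IHn (Member CA') (leq_trans (splits_proper (splits_sym sp)) Zn) A'0.
have mem_half (H H' : {set S}) (CH : H \in members C) X : [disjoint H & H'] ->
    H \subset val Z -> refines (val Z) B H H' ->
    X \in maximals [set X in B | (X <= Member CH)%O] ->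
    X \in maximals [set X in B | (X <= Z)%O].
  move=> HH' HZ ref; rewrite !inE => /andP[/andP[BX XH] /forall_inP Xmax].
  have XZ : (X <= Z)%O := subset_trans XH HZ.
  rewrite BX XZ; apply/forall_inP=> Y; rewrite inE.
  case/andP=> BY YZ; apply/implyP=> XY.
  have [YH|YH'] := ref Y BY YZ.
    by have := Xmax Y; rewrite !inE BY leE YH XY => /(_ isT).
  case/negP: B0; suff <- : X = \bot%O by [].
  apply/eqP; rewrite bottomE -subset0 -(disjoint_setI0 HH') subsetI.
  by apply/andP; split; [exact: XH | exact: subset_trans XY YH'].
have half_mem X : X \in maximals [set X in B | (X <= Z)%O] ->
    X \in maximals [set X in B | (X <= Member CA)%O] \/
    X \in maximals [set X in B | (X <= Member CA')%O].
  rewrite !inE => /andP[/andP[BX XZ] /forall_inP Xmax].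
  have Xmax_in (H : {set S}) : H \subset val Z ->
      [forall Y in [set Y in B | val Y \subset H], (X <= Y)%O ==> (Y == X)].
    move=> HZ; apply/forall_inP=> Y; rewrite inE => /andP[BY YH]; apply: Xmax.
    by rewrite inE BY; exact: subset_trans YH HZ.
  by have [XA|XA'] := Bref X BX XZ; [left | right];
    rewrite BX leE /= ?XA ?XA'; exact: Xmax_in.
have A'A : [disjoint A' & A] by rewrite disjoint_sym.
have ref' : refines (val Z) B A' A.
  by move=> X BX XZ; have [] := Bref X BX XZ; auto.
split=> [X|X Y|x|W WZ Wcl].
- by rewrite !inE => /andP[/andP[]].
- by case/half_mem=> KX; case/half_mem=> KY XY;
    [exact: dA | apply: disjointW AA' | apply: disjointW A'A | exact: dA'];
    auto.
- rewrite -AUA' inE => /orP[/cA|/cA'] [X KX xX]; exists X => //.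
    exact: mem_half AA' AZ Bref KX.
  exact: mem_half A'A A'Z ref' KX.
- rewrite -(setIidPl WZ) -AUA' setIUr; apply: Acl; rewrite ?subsetIr //.
    apply: clA => [|X KX]; first exact: subsetIr.
    rewrite -setIA (setIidPr (KA X KX)); apply: Wcl.
    exact: mem_half AA' AZ Bref KX.
  apply: clA' => [|X KX]; first exact: subsetIr.
  rewrite -setIA (setIidPr (KA' X KX)); apply: Wcl.
  exact: mem_half A'A A'Z ref' KX.
Qed.

Lemma splitting_building B : \bot%O \notin B -> splitting B -> building_set B.
Proof.
move=> B0 Bsplit; split=> // Z; rewrite bottomE => Z0.
exact/decomposes_factorization/splitting_decomposes.
Qed.

End Families.
(** * Faces and flats of an oriented matroid *)

Section OrientedMatroids.
Variables (S : finType) (M : oriented_matroid S).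
Implicit Types (u v w : sign_vector S) (A B F X Z : {set S}).

Local Notation cl := (hull (flat_family M)).

Lemma flatP X :
  reflect (exists2 v, v \in covectors M & X = ~: supp v) (X \in flats M).
Proof. exact: imsetP. Qed.

Lemma flat_setC_supp v : v \in covectors M -> ~: supp v \in flats M.
Proof. by move=> cv; apply/flatP; exists v. Qed.

(** Elimination for supports: up to replacing [v] by its opposite, [s]
    separates [u] from [v], and outside the support of [v] the result agrees
    with [u]. *)
Lemma supp_elim u v s :
    u \in covectors M -> v \in covectors M -> s \in supp u -> s \in supp v ->
  exists w, [/\ w \in covectors M, s \notin supp w
    & forall x, x \notin supp v -> (x \in supp w) = (x \in supp u)].
Proof.
wlog sep_s : v / s \in sep u v => [IH|] cu cv us vs.
  have [sep_s|] := boolP (s \in sep u v); first exact: IH.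
  rewrite !inE in us vs * => Nsep.
  have [|||w [cw ws wE]] := IH (sv_opp v) _ cu (covector_opp cv).
  - by rewrite !inE /=; move: us vs Nsep; do !case: (s \in _).
  - by rewrite !inE.
  - by rewrite !inE orbC.
  exists w; split=> // x xv; apply: wE; apply: contra xv.
  by rewrite !inE orbC.
have [w cw [ws w1 w2]] := covector_elim cu cv sep_s.
exists w; split=> // x; rewrite !inE negb_or => /andP[/negPf v1x /negPf v2x].
move/setP/(_ x): w1; move/setP/(_ x): w2.
by rewrite !inE v1x v2x !andbF !orbF /= => -> ->.
Qed.

(** If a flat with covector [v] contained [f] and [X] but not [e], eliminating
    [e] between [v] and a covector of [X] would give a flat that contains [e]
    and [X] but not [f]. *)
Lemma flat_exchange X e f : X \in flats M -> f \notin X ->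
  f \in cl (e |: X) -> e \in cl (f |: X).
Proof.
case/flatP=> u cu ->{X}; rewrite inE negbK => uf fcl.
apply/mem_hullP=> W /flatP[v cv ->]; rewrite subUset sub1set => /andP[vf uv].
apply: contraTT fcl => ev.
have ue : e \in supp u.
  by apply: contraR ev => ue; apply: (subsetP uv); rewrite inE.
have ve : e \in supp v by rewrite inE negbK in ev.
have [w [cw we wE]] := supp_elim cu cv ue ve.
apply/negP=> /mem_hullP/(_ _ (flat_setC_supp cw)).
rewrite inE -[f \in supp w]negbK wE ?uf ?negbK; last by rewrite inE in vf.
suff -> : e |: ~: supp u \subset ~: supp w by move/(_ isT).
apply/subsetP=> x; rewrite !inE => /predU1P[->|]; first by rewrite !inE in we.
move=> xu; have := subsetP uv x; rewrite !inE => /(_ xu) xv.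
by have := wE x; rewrite !inE => -> .
Qed.

(** In the realizable case, take a linear form [v] that vanishes on [X] and is
    positive at [e], and add to it larger and larger multiples of the
    nonnegative form of [F], until the sum becomes nonnegative on [Z]; as [v]
    is not positive everywhere on [Z :\: F], some zero outside [F] remains,
    while [e] stays positive. Each addition is here an elimination, which
    removes an element from the negative part of [v] in [Z]. *)
Lemma face_enlarge F Z X e :
    F \in faces M -> Z \in faces M -> X \in flats M ->
    F \proper X -> X \subset Z -> e \in Z -> e \notin X ->
  exists F', [/\ F' \in faces M, F \proper F', F' \subset Z & e \notin F'].
Proof.
move=> fF fZ fX FX XZ eZ eX.
(* The witness t records that v is not positive on all of Z :\: F. *)
suff pushed v t : v \in covectors M -> F \subset ~: supp v -> e \in v.1 ->
    t \in Z :\: F -> t \notin v.1 ->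
    exists F', [/\ F' \in faces M, F \proper F', F' \subset Z & e \notin F'].
  have /flatP[v cv Xv] := fX; have [FsX [t tX tF]] := properP FX.
  have tv : t \notin supp v by move: tX; rewrite Xv inE.
  have: e \in supp v by move: eX; rewrite Xv inE negbK.
  have tZF : t \in Z :\: F by rewrite inE tF (subsetP XZ).
  have FNv : F \subset ~: supp v by rewrite -Xv.
  rewrite inE => /orP[ev|ev].
    apply: (pushed v t) => //; apply: contra tv; rewrite inE => -> //.
  apply: (pushed (sv_opp v) t) => //; first exact: covector_opp.
    by rewrite /supp setUC.
  by apply: contra tv; rewrite inE orbC => ->.
have [n] := ubnP #|v.2 :&: Z|; elim: n => // n IHn in v t *.
rewrite ltnS => vn cv Fv ev tZF tv.
have Fv1 x : x \in F -> x \notin v.1.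
  by move=> xF; have := subsetP Fv x xF; rewrite !inE negb_or => /andP[].
have Fv2 x : x \in F -> x \notin v.2.
  by move=> xF; have := subsetP Fv x xF; rewrite !inE negb_or => /andP[].
have FZ : F \subset Z by rewrite (subset_trans (proper_sub FX)).
have [v2Z0|[s]] := set_0Vmem (v.2 :&: Z).
  (* v is nonnegative on Z: compose the covector of Z with it *)
  exists (Z :\: v.1); split; last by rewrite inE ev.
  - rewrite inE.
    suff -> : (~: (Z :\: v.1), set0) = sv_comp (~: Z, set0) v.
      by apply: covector_comp => //; rewrite inE in fZ.
    rewrite /sv_comp /supp /= setU0; congr pair; apply/setP=> x; rewrite !inE.
      by do 2!case: (_ \in _).
    by move: v2Z0 => /setP/(_ x); rewrite !inE negbK andbC => ->.
  - apply/properP; split; last first.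
      by exists t; move: tZF; rewrite !inE ?tv => /andP[].
    by apply/subsetP=> x xF; rewrite inE (Fv1 x xF) (subsetP FZ).
  - exact: subsetDl.
rewrite inE => /andP[sv sZ].
have sF : s \notin F by apply: contraL sv => /Fv2.
have cF : (~: F, set0) \in covectors M by rewrite inE in fF.
have sepE : sep (~: F, set0) v = v.2.
  rewrite /sep /= set0I setU0; apply/setP=> x; rewrite !inE.
  by case: (boolP (x \in v.2)); rewrite ?andbF // => /(contraL (@Fv2 x)) ->.
have [w cw [ws w1 w2]] : exists2 w, w \in covectors M &
    [/\ s \notin supp w,
        w.1 :\: v.2 = (sv_comp (~: F, set0) v).1 :\: v.2
      & w.2 :\: v.2 = (sv_comp (~: F, set0) v).2 :\: v.2].
  have : s \in sep (~: F, set0) v by rewrite sepE.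
  by move=> sep_s; have := covector_elim cF cv sep_s; rewrite sepE.
have w1E x : x \notin v.2 -> (x \in w.1) = (x \notin F).
  move=> xv; move/setP/(_ x): w1; rewrite !inE xv /= orbF => ->.
  by rewrite negbK; case: (boolP (x \in F)) => // /Fv1/negPf->.
have w2E x : x \notin v.2 -> x \notin w.2.
  move=> xv; move/setP/(_ x): w2; rewrite !inE xv /= (negPf xv) => ->.
  by rewrite andbF.
have vdisj := covector_disjoint cv.
apply: (IHn w s) => //.
- apply: leq_trans vn; apply: proper_card; apply/properP; split.
    apply/subsetP=> x; rewrite !inE => /andP[xw ->]; rewrite andbT.
    by apply: contraLR xw; exact: w2E.
  exists s; rewrite inE ?sv ?sZ //.
  by move: ws; rewrite inE negb_or andbT => /andP[].
- apply/subsetP=> x xF; have xv := Fv2 x xF.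
  by rewrite !inE negb_or w1E // w2E // xF.
- rewrite w1E ?(disjointFr vdisj) //; apply: contraL ev; exact: Fv1.
- by rewrite inE sF.
- by move: ws; rewrite inE negb_or => /andP[].
Qed.

(** A maximal proper subface is covered by [F] already among flats, since
    [face_enlarge] would turn a flat in between into a face in between. *)
Lemma facet_exists F : set0 \in faces M -> F \in faces M -> F != set0 ->
  exists F', [/\ F' \in faces M, F' \proper F
    & forall X, X \in flats M -> F' \proper X -> X \subset F -> X = F].
Proof.
move=> f0 fF F0.
pose P F' := (F' \in faces M) && (F' \proper F).
have P0 : P set0 by rewrite /P f0 proper0.
have [F' /andP[fF' F'F] F'max] := arg_maxnP (fun F' : {set S} => #|F'|) P0.
exists F'; split=> // X fX F'X XF; apply/eqP; rewrite eqEsubset XF.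
apply: contraT => /subsetPn[e eF eX].
have [F'' [fF'' F'F'' F''F eF'']] := face_enlarge fF' fF fX F'X XF eF eX.
have := F'max F''; rewrite /P fF'' properE F''F => /=.
have -> : ~~ (F \subset F'') by apply/subsetPn; exists e.
by move/(_ isT); rewrite leqNgt proper_card.
Qed.

(** One step down a chain of faces of [A] in which [F] covers [F'] among
    flats. If [X :|: B] is not closed, its hull contains [F], since an excess
    element can be exchanged for any [g] in [F :\: X]. Compare with a flat
    [X'] covered by [X]: exchange of [g] for an element [x] of [X :\: X']
    holds modulo [B], and the flats that contain [F] do not see [B], so it
    holds without [B] too and puts [g] into [X]. *)
Lemma flat_union_step A B F F' :
    A \in faces M -> [disjoint A & B] -> F \subset A ->
    (forall X, X \in flats M -> F' \proper X -> X \subset F -> X = F) ->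
    F' \subset F -> F' \in flats M -> F \in faces M -> F' :|: B \in flats M ->
    (forall X, X \in flats M -> F \subset X -> X \subset A ->
       X :|: B \in flats M) ->
  forall X, X \in flats M -> F' \subset X -> X \subset A ->
    X :|: B \in flats M.
Proof.
move=> fA AB FA F'F F'sF fF' fF F'B PF X.
have [n] := ubnP #|X|; elim: n => // n IHn in X *.
rewrite ltnS => Xn fX F'X XA.
have [FX|] := boolP (F \subset X); first exact: PF.
case/subsetPn=> g gF gX.
have gA := subsetP FA g gF.
have gB : g \notin B by rewrite (disjointFr AB).
have joinB (Y : {set S}) : F' \subset Y -> Y \subset A -> g \notin Y ->
    cl (g |: Y) :|: B \in flats M.
  move=> F'Y YA gY; have YgY : Y \subset g |: Y := subsetUr _ _.
  apply: PF; first exact: hull_in.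
    suff <- : F :&: cl (g |: Y) = F by exact: subsetIr.
    apply: F'F; rewrite ?subsetIl //.
      by apply: flats_setI; [exact: face_is_flat | exact: hull_in].
    apply/properP; split.
      rewrite subsetI F'sF (subset_trans F'Y) //.
      exact: subset_trans YgY (sub_hull _ _).
    exists g; last by apply: contra gY => /(subsetP F'Y).
    by rewrite inE gF (subsetP (sub_hull _ _)) ?setU11.
  apply: (hull_sub (C := flat_family M)) (face_is_flat fA) _.
  by rewrite subUset sub1set gA.
have [->//|XF'] := eqVneq X F'.
pose P (Y : {set S}) := [&& Y \in flats M, F' \subset Y & Y \proper X].
have P' : P F'.
  by rewrite /P fF' subxx properEneq eq_sym XF' F'X.
have [X' /and3P[fX' F'X' X'X] X'max] := arg_maxnP (fun Y : {set S} => #|Y|) P'.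
have [X'sX [x xX xX']] := properP X'X.
have xA := subsetP XA x xX.
have X'B : X' :|: B \in flats M.
  by apply: IHn; rewrite ?(leq_trans (proper_card X'X)) ?(subset_trans X'sX).
have XE : X \subset cl (x |: X').
  have clX : cl (x |: X') \subset X.
    by apply: (hull_sub (C := flat_family M)) fX _; rewrite subUset sub1set xX.
  apply: contraT => nX; have := X'max (cl (x |: X')).
  rewrite /P [_ \in _]hull_in properE clX nX /=.
  have X'cl : X' \subset cl (x |: X').
    by apply: subset_trans (sub_hull _ _); exact: subsetUr.
  rewrite (subset_trans F'X' X'cl) => /(_ isT).
  rewrite leqNgt proper_card //; apply/properP; split=> //; exists x => //.
  by rewrite (subsetP (sub_hull _ _)) ?setU11.
suff clXB : cl (X :|: B) \subset X :|: B.
  suff -> : X :|: B = cl (X :|: B) by exact: hull_in.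
  by apply/eqP; rewrite eqEsubset sub_hull.
apply/subsetP=> e eXB; apply: contraT; rewrite inE negb_or => /andP[eX eB].
have gXB : g \in cl (X :|: B).
  have : e \in cl (g |: X) :|: B.
    apply: mem_hull_sub eXB _ _; first exact: joinB.
    apply: setSU; apply: subset_trans (sub_hull _ _); exact: subsetUr.
  rewrite inE (negPf eB) orbF => /(flat_exchange fX eX)/mem_hull_sub; apply.
    exact: hull_in.
  rewrite subUset sub1set eXB; apply: subset_trans (sub_hull _ _).
  exact: subsetUl.
have gX'B : g \notin X' :|: B.
  by rewrite inE negb_or gB andbT; apply: contra gX => /(subsetP X'sX).
have : g \in cl (x |: (X' :|: B)).
  apply: mem_hull_sub gXB (hull_in _ _) _.
  rewrite subUset (subset_trans XE) /=; last first.
    by rewrite setUA hull_mono ?subsetUl.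
  by apply: subset_trans (sub_hull _ _); rewrite setUA subsetUr.
move/(flat_exchange X'B gX'B) => xcl.
have gX' : g \notin X' by apply: contra gX => /(subsetP X'sX).
have : x \in cl (g |: X') :|: B.
  apply: mem_hull_sub xcl _ _.
    by apply: joinB; rewrite ?(subset_trans X'sX).
  by rewrite setUA; apply: setSU; exact: sub_hull.
rewrite inE (disjointFr AB xA) orbF => /(flat_exchange fX' xX').
move/mem_hull_sub/(_ fX)=> gcl; case/negP: gX; apply: gcl.
by rewrite subUset sub1set xX.
Qed.

(** The flats inside [A], and the traces on [A] of the flats that contain [B],
    are the flats of two matroids on [A], the second a quotient of the first.
    The faces inside [A] are flats of both and contain a chain that is maximal
    for the first, so the ranks agree and the two matroids coincide. The chain
    is built downwards from [A]. *)
Lemma flat_union_of_faces A B :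
    set0 \in faces M -> A \in faces M -> B \in flats M -> [disjoint A & B] ->
    (forall F, F \in faces M -> F \subset A -> F :|: B \in flats M) ->
  forall X, X \in flats M -> X \subset A -> X :|: B \in flats M.
Proof.
move=> f0 fA fB AB FB.
suff down n F : #|F| < n -> F \in faces M -> F \subset A ->
    (forall X, X \in flats M -> F \subset X -> X \subset A ->
       X :|: B \in flats M) ->
    forall X, X \in flats M -> X \subset A -> X :|: B \in flats M.
  apply: (down #|A|.+1 A) => // X fX AX XA.
  suff -> : X = A by exact: FB.
  by apply/eqP; rewrite eqEsubset XA.
elim: n F => // n IHn F; rewrite ltnS => Fn fF FA PF X fX XA.
have [F0|F0] := eqVneq F set0; first by apply: PF; rewrite // F0 sub0set.
have [F' [fF' F'F cov]] := facet_exists f0 fF F0.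
have F'A : F' \subset A := subset_trans (proper_sub F'F) FA.
apply: (IHn F') => //; first exact: leq_trans (proper_card F'F) Fn.
apply: flat_union_step fA AB FA cov (proper_sub F'F) _ fF _ PF.
  exact: face_is_flat.
exact: FB.
Qed.

Lemma acyclic_face0 : acyclic M -> set0 \in faces M.
Proof. by rewrite inE setC0. Qed.

(** It must be shown that [U :|: H'] is a face when [U] is a face of a half
    [H]. For [e] outside it, let [F] be a maximal face that contains [U] and
    avoids [e]. If [F] did not contain [H'], adding [H'] to it would give a
    larger flat avoiding [e], and [face_enlarge] a larger face avoiding [e].
    So the intersection of the faces that contain [U :|: H'] has no further
    element. *)
Lemma splits_faces Z A A' : acyclic M -> Z \in faces M ->
  splits (flat_family M) Z A A' -> splits (face_family M) Z A A'.
Proof.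
move=> /acyclic_face0 f0 fZ.
have half (H H' : {set S}) : splits (flat_family M) Z H H' ->
    forall U, U \in faces M -> U \subset H -> U :|: H' \in faces M.
  case=> fH fH' _ _ HH' HUH' Hcl U fU UH.
  have UH'Z : U :|: H' \subset Z by rewrite -HUH' setSU.
  suff sub : hull (face_family M) (U :|: H') \subset U :|: H'.
    suff -> : U :|: H' = hull (face_family M) (U :|: H') by exact: hull_in.
    by apply/eqP; rewrite eqEsubset sub_hull.
  apply/subsetP=> e eW; apply: contraT; rewrite inE negb_or => /andP[eU eH'].
  have eZ : e \in Z by exact: mem_hull_sub eW _ _.
  have UZ : U \subset Z by rewrite (subset_trans _ UH'Z) ?subsetUl.
  pose P F := [&& F \in faces M, U \subset F, F \subset Z & e \notin F].
  have PU : P U by apply/and4P.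
  have [F /and4P[fF UF FZ eF] Fmax] := arg_maxnP (fun F : {set S} => #|F|) PU.
  have [H'F|H'F] := boolP (H' \subset F).
    by case/negP: eF; apply: mem_hull_sub eW _ _; rewrite // subUset UF.
  have fY : (F :&: H) :|: H' \in flats M.
    apply: Hcl; rewrite ?subsetIr //; apply: flats_setI => //.
    exact: face_is_flat.
  have FY : F \proper (F :&: H) :|: H'.
    rewrite properE subUset (negPf H'F) andbF andbT.
    by rewrite -{1}(setIidPl FZ) -HUH' setIUr setUS ?subsetIr.
  have YZ : (F :&: H) :|: H' \subset Z by rewrite -HUH' setSU ?subsetIr.
  have eY : e \notin (F :&: H) :|: H' by rewrite !inE (negPf eF) (negPf eH').
  have [F' [fF' FF' F'Z eF']] := face_enlarge fF fZ fY FY YZ eZ eY.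
  have /Fmax : P F' by apply/and4P; rewrite (subset_trans UF (proper_sub FF')).
  by rewrite /= leqNgt proper_card.
move=> sp; have [_ _ A0 A'0 AA' AUA' _] := sp.
by apply: splits_of_halves => //; [exact: half | exact/half/splits_sym].
Qed.

Lemma splits_flats Z A A' : acyclic M ->
  splits (face_family M) Z A A' -> splits (flat_family M) Z A A'.
Proof.
move=> /acyclic_face0 f0 sp; have [fA fA' A0 A'0 AA' AUA' Acl] := sp.
apply: splits_of_halves => //; first exact: face_is_flat.
  apply: flat_union_of_faces => //; first exact: face_is_flat.
  by move=> F fF FA; apply/face_is_flat/Acl.
apply: flat_union_of_faces => //; first exact: face_is_flat.
  by rewrite disjoint_sym.
by move=> F fF FA'; rewrite setUC; apply/face_is_flat/Acl.
Qed.

Lemma flat_point_sym x y : acyclic M -> x \in cl [set y] -> y \in cl [set x].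
Proof.
move=> /acyclic_face0/face_is_flat f0; rewrite -[[set y]]setU0 -[[set x]]setU0.
by apply: flat_exchange; rewrite // inE.
Qed.

End OrientedMatroids.

(** * Facial and flatial building sets *)

Section Nested.
Variables (S : finType) (M : oriented_matroid S).
Hypothesis acM : acyclic M.
Implicit Types (G : {set flat_lattice M}) (F : {set face_lattice M}).

Local Notation face_fam := (face_family M).
Local Notation flat_fam := (flat_family M).

Lemma face0 : set0 \in members face_fam.
Proof. exact: acyclic_face0. Qed.

Definition face_of Z (fZ : Z \in faces M) : face_lattice M :=
  @Member S face_fam Z fZ.

Lemma flat0 : set0 \in members flat_fam.
Proof. exact: face_is_flat face0. Qed.

Lemma face_flat_inj : injective (@face_flat S M).
Proof. by move=> X Y /(congr1 val) XY; exact: member_inj. Qed.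

Lemma flat_building_splitting G : building_set G -> splitting G.
Proof. by apply: (building_splitting flat0) => x y; exact: flat_point_sym. Qed.

Lemma facial_splitting G (Z : face_lattice M) :
    building_set G -> val Z != set0 -> face_flat Z \notin G ->
  exists A A', splits face_fam (val Z) A A' /\ refines (val Z) G A A'.
Proof.
move=> /flat_building_splitting Gsplit Z0 GZ.
have [A [A' [sp ref]]] := Gsplit (face_flat Z) Z0 GZ.
by exists A, A'; split; [exact: splits_faces acM (valP Z) sp |].
Qed.

Lemma facial_part_building G : building_set G -> building_set (facial_part G).
Proof.
move=> Gb; apply: (splitting_building face0).
  rewrite inE; have [G0 _] := Gb.
  suff -> : @face_flat S M \bot%O = \bot%O by [].
  by apply: member_inj; rewrite (val_bottom flat0); exact: val_bottom face0.
move=> Z Z0; rewrite inE => GZ.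
have [A [A' [sp ref]]] := facial_splitting Gb Z0 GZ.
by exists A, A'; split=> // X; rewrite inE => /ref.
Qed.

(** When [setT] is split along [G] again and again, [X] always lies in one of
    the halves, which are faces; a half that belongs to [G] and contains [X]
    is equal to [X]. *)
Lemma maximal_is_face G X :
  building_set G -> X \in maximals G -> val X \in faces M.
Proof.
move=> Gb; rewrite inE => /andP[GX /forall_inP Xmax].
suff below n (Z : {set S}) : #|Z| < n -> Z \in faces M -> val X \subset Z ->
    (forall Y, Y \in G -> val Y \subset Z -> (X <= Y)%O -> Y = X) ->
    val X \in faces M.
  apply: (below #|S|.+1 setT); rewrite ?cardsT ?faces_setT ?subsetT //.
  by move=> Y GY _ XY; apply/eqP/(implyP (Xmax Y GY)).
elim: n Z => // n IHn Z; rewrite ltnS => Zn fZ XZ XmaxZ.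
pose ZF := face_of fZ.
have [Z0|Z0] := eqVneq Z set0.
  by suff -> : val X = Z by []; apply/eqP; rewrite eqEsubset XZ Z0 sub0set.
have [GZ|GZ] := boolP (face_flat ZF \in G); first by rewrite -(XmaxZ _ GZ).
have [A [A' [sp ref]]] := facial_splitting Gb (Z0 : val ZF != set0) GZ.
have descend (H H' : {set S}) :
    splits face_fam Z H H' -> val X \subset H -> val X \in faces M.
  move=> spH XH; have [fH _ _ _ _ HUH' _] := spH.
  have HZ : H \subset Z by rewrite -HUH' subsetUl.
  apply: (IHn H) => //; last first.
    by move=> Y GY YH; apply: XmaxZ; rewrite ?(subset_trans YH).
  exact: leq_trans (splits_proper spH) Zn.
have [|] := ref X GX XZ; first exact: descend sp.
exact: descend (splits_sym sp).
Qed.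

Lemma maximals_facial G (X : face_lattice M) : building_set G ->
  (X \in maximals (facial_part G)) = (face_flat X \in maximals G).
Proof.
move=> Gb; rewrite !inE; apply: andb_id2l => GX.
apply/forall_inP/forall_inP => Xmax Y; last first.
  rewrite inE => /Xmax/implyP GYX; apply/implyP=> XY.
  by rewrite -(inj_eq face_flat_inj) GYX.
move=> GY; apply/implyP=> XY.
have [W Wmax YW] := maximal_below (Z := \top%O) GY (lex1 Y).
have {}Wmax : W \in maximals G.
  rewrite (_ : G = [set X in G | (X <= \top)%O]) //.
  by apply/setP=> V; rewrite inE lex1 andbT.
pose WF := face_of (maximal_is_face Gb Wmax).
have WE : face_flat WF = W by exact: member_inj.
have XW : (X <= WF)%O by exact: subset_trans XY YW.
have GW : WF \in facial_part G by have := Wmax; rewrite !inE WE => /andP[].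
have /implyP/(_ XW)/eqP WX := Xmax WF GW.
by apply/eqP/le_anti; rewrite XY -WX WE andbT; exact: YW.
Qed.

(** A splitting along [G] of the join in the face lattice would have the join
    in the flat lattice inside one half. This half is a face, hence contains
    the join in the face lattice and leaves nothing for the other half. *)
Lemma join_in_facial_part G (A : {set face_lattice M}) : building_set G ->
    (exists2 X, X \in A & val X != set0) ->
  (\join_(X in A) face_flat X)%O \in G ->
  (\join_(X in A) X)%O \in facial_part G.
Proof.
move=> Gb [X0 AX0 X00] GJ; rewrite inE; apply: contraT => GW.
set J := (\join_(X in A) face_flat X)%O in GJ.
set W := (\join_(X in A) X)%O in GW.
have XW X : X \in A -> (X <= W)%O by move=> AX; exact: joins_sup.
have JW : val J \subset val W.
  rewrite -[_ \subset _]/(J <= face_flat W)%O.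
  by apply/joinsP=> X AX; exact: XW.
have XJ X : X \in A -> val X \subset val J.
  by move=> AX; exact: (joins_sup (@face_flat S M) AX).
have W0 : val W != set0.
  by apply: contra X00; rewrite -!subset0; apply: subset_trans; exact: XW.
have [A1 [A2 [sp ref]]] := facial_splitting Gb W0 GW.
have absurd (H H' : {set S}) :
    splits face_fam (val W) H H' -> val J \subset H -> false.
  case=> fH _ _ H'0 HH' HUH' _ JH; case/negP: H'0.
  have WH : val W \subset H.
    suff : (W <= face_of fH)%O by [].
    by apply/joinsP=> X AX; exact: subset_trans (XJ X AX) JH.
  rewrite -subset0 -(disjoint_setI0 HH') subsetI subxx andbT.
  by apply: subset_trans WH; rewrite -HUH' subsetUr.
have [|] := ref J GJ JW; first exact: absurd sp.
exact: absurd (splits_sym sp).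
Qed.

Lemma facial_nested_subcomplex G : building_set G ->
  subcomplex (nested_complex (facial_part G)) (nested_complex G).
Proof.
move=> Gb N /imsetP[N0]; rewrite inE => /and3P[N0G maxN0 /forallP nestN0] ->{N}.
have imD : @face_flat S M @: (N0 :\: maximals (facial_part G)) =
    (@face_flat S M @: N0) :\: maximals G.
  apply/setP=> X; rewrite inE; apply/imsetP/andP => [[Y]|[XG /imsetP[Y NY XE]]].
    by rewrite inE maximals_facial // => /andP[YG NY] ->; rewrite YG imset_f.
  by exists Y; rewrite // inE NY maximals_facial // -XE XG.
apply/imsetP; exists (@face_flat S M @: N0) => //; rewrite inE.
apply/and3P; split.
- apply/subsetP=> _ /imsetP[X NX ->].
  by have := subsetP N0G X NX; rewrite inE.
- apply/subsetP=> X Xmax.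
  pose XF := face_of (maximal_is_face Gb Xmax).
  have XE : X = face_flat XF by exact: member_inj.
  rewrite XE imset_f // (subsetP maxN0) // maximals_facial // -XE //.
apply/forallP=> A; apply/implyP=> /and3P[AN A1 /forall_inP Aanti].
pose A0 : {set face_lattice M} := @face_flat S M @^-1: A.
have AE : A = @face_flat S M @: A0.
  apply/setP=> X; apply/idP/imsetP => [AX|[Y + ->]]; last by rewrite inE.
  have := subsetP AN X AX; rewrite -imD => /imsetP[Y _ XE].
  by exists Y; rewrite // inE -XE.
have card_A0 : 1 < #|A0|.
  by rewrite AE card_imset // in A1; exact: face_flat_inj.
have A0N : A0 \subset N0 :\: maximals (facial_part G).
  apply/subsetP=> X; rewrite inE => /(subsetP AN); rewrite -imD.
  by case/imsetP=> Y NY /face_flat_inj ->.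
have A0anti : antichain A0.
  apply/forall_inP=> X; rewrite inE => /Aanti/forall_inP AX.
  apply/forall_inP=> Y; rewrite inE => /AX.
  by rewrite (inj_eq face_flat_inj).
have := nestN0 A0; rewrite A0N card_A0 A0anti; apply: contra.
rewrite AE big_imset /=; last by move=> X Y _ _; exact: face_flat_inj.
apply: join_in_facial_part => //.
have /set0Pn[X AX] : A0 != set0 by rewrite -card_gt0 ltnW.
exists X => //; rewrite -bottomE; last exact: face0.
have /(subsetP A0N) := AX; rewrite inE => /andP[_ /(subsetP N0G)].
by apply: contraTneq => ->; have [] := facial_part_building Gb.
Qed.

Lemma face_building_splitting F : (forall s, [set s] \in faces M) ->
  building_set F -> splitting F.
Proof.
move=> fs; apply: (building_splitting face0) => x y.
move/mem_hull_sub/(_ (fs y))/(_ (subxx _)); rewrite inE => /eqP ->.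
by rewrite -sub1set sub_hull.
Qed.

(** The set [G'] of the [tame] elements of [G] has no faces outside [F]. To
    see that it is a building set, split a flat [Z] of [G] that is not tame
    along a smallest face [Y] that witnesses this: [Y] is not in [F], hence
    splits along [F], also among flats, and by minimality [Z] meets both
    halves. *)
Lemma closure_facial_part F G : (forall s, [set s] \in faces M) ->
    building_set F -> building_closure (@face_flat S M @: F) G ->
  facial_part G = F.
Proof.
move=> fs Fb [Gb FG Gmin].
pose tame (X : flat_lattice M) := [forall Y : face_lattice M,
  (val X \subset val Y) ==>
    [exists B in F, (val X \subset val B) && (val B \subset val Y)]].
pose G' := [set X in G | tame X].
have G'G : G' \subset G by apply/subsetP=> X; rewrite inE => /andP[].
have FG' : @face_flat S M @: F \subset G'.
  apply/subsetP=> _ /imsetP[X FX ->]; rewrite inE (subsetP FG) ?imset_f //=.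
  apply/forallP=> Y; apply/implyP=> XY; apply/exists_inP; exists X => //.
  by rewrite XY andbT; exact: subxx.
have G'split : splitting G'.
  move=> Z Z0; rewrite inE; have [GZ /= |GZ _] := boolP (Z \in G); last first.
    have [A [A' [sp ref]]] := flat_building_splitting Gb Z0 GZ.
    by exists A, A'; split=> // X /(subsetP G'G); exact: ref.
  case/forallPn=> Y1; rewrite negb_imply => wild1.
  pose wild (Y : face_lattice M) := (val Z \subset val Y) &&
    ~~ [exists B in F, (val Z \subset val B) && (val B \subset val Y)].
  have [Y /andP[ZY /exists_inPn FY] Ymin] :=
    @arg_minnP _ Y1 wild (fun Y => #|val Y|) wild1.
  have Y0 : val Y != set0.
    by apply: contra Z0; rewrite -!subset0; exact: subset_trans.
  have FYn : Y \notin F by apply/negP=> /FY; rewrite ZY subxx.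
  have [A [A' [sp ref]]] := face_building_splitting fs Fb Y0 FYn.
  have spfl := splits_flats acM sp; have [fA fA' A0 A'0 AA' AUA' Acl] := spfl.
  have meets (H H' : {set S}) :
      splits face_fam (val Y) H H' -> val Z :&: H' != set0.
    move=> spH; have [fH _ _ _ _ HUH' _] := spH; apply/negP=> /eqP ZH'.
    have ZH : val Z \subset H.
      by rewrite -(setIidPl ZY) -HUH' setIUr ZH' setU0 subsetIr.
    have HY : H \subset val Y by rewrite -HUH' subsetUl.
    have : wild (face_of fH).
      rewrite /wild ZH /=; apply/exists_inPn=> B FB; apply: contra (FY B FB).
      by case/andP=> -> BH; exact: subset_trans BH HY.
    by move/Ymin; rewrite /= leqNgt (splits_proper spH).
  exists (val Z :&: A), (val Z :&: A'); split; last first.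
    move=> X; rewrite inE => /andP[_ /forallP Xtame] XZ.
    have := Xtame Y; rewrite (subset_trans XZ ZY).
    case/exists_inP=> B FB /andP[XB BY].
    by rewrite !subsetI XZ; have [BA|BA'] := ref B FB BY; [left | right];
      exact: subset_trans XB _.
  split=> //.
  - by apply: members_setI => //; exact: valP.
  - by apply: members_setI => //; exact: valP.
  - exact: meets (splits_sym sp).
  - exact: meets sp.
  - by apply: disjointW AA'; exact: subsetIr.
  - by rewrite -setIUr AUA'; apply/setIidPl.
  - move=> U V fU fV; rewrite !subsetI => /andP[_ UA] /andP[_ VA'].
    exact: Acl.
have G'b : building_set G'.
  apply: (splitting_building flat0) G'split; rewrite inE negb_and.
  by have [-> _] := Gb.
have GE := Gmin G' G'b FG' G'G.
apply/setP=> Y; rewrite inE; apply/idP/idP => [|FY]; last first.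
  by rewrite (subsetP FG) ?imset_f.
rewrite -GE inE => /andP[_ /forallP/(_ Y)]; rewrite subxx.
case/exists_inP=> B FB YBY.
by suff -> : Y = B by []; apply/le_anti.
Qed.

End Nested.

Theorem corollary14p10 (S : finType) (M : oriented_matroid S) :
  acyclic M ->
  (forall G : {set flat_lattice M},
     building_set G ->
     building_set (facial_part G) /\
     subcomplex (nested_complex (facial_part G)) (nested_complex G)) /\
  ((forall s : S, [set s] \in faces M) ->
   forall (F : {set face_lattice M}) (G : {set flat_lattice M}),
     building_set F ->
     building_closure (@face_flat S M @: F) G ->
     subcomplex (nested_complex F) (nested_complex G)).
Proof.
move=> acM; split=> [G Gb|fs F G Fb Gcl].
  by split; [exact: facial_part_building | exact: facial_nested_subcomplex].
rewrite -(closure_facial_part acM fs Fb Gcl).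
by have [Gb _ _] := Gcl; exact: facial_nested_subcomplex.
Qed.
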